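(* There is an algorithm that, given a word $w$ of length $n$ over $V$, decides whether $w$ is an ins-robust primitive word in $O(n)$ time.
   Context: $V$ is a fixed finite alphabet with at least two distinct letters. A nonempty word is primitive if it is not of the form $v^k$ for a word $v$ and an integer $k \ge 2$. For a word $w$ of length $n$, $w[1..i]$ denotes its prefix of length $i$ and $w[i+1..n]$ its suffix of length $n-i$. A primitive word $w$ of length $n$ is ins-robust if for every $i \in \{0,\ldots,n\}$ and every $a \in V$ the word $w[1..i]\,a\,w[i+1..n]$ is primitive. *)

(* Defs.v *)
From mathcomp Require Import all_boot.
Set Implicit Arguments.
Unset Strict Implicit.
Unset Printing Implicit Defensive.

Section Words.
Variable V : finType.
Implicit Types (w v : seq V) (a : V).

Definition wpow v (k : nat) : seq V := flatten (nseq k v).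

Definition primitive_word w : Prop :=
  w <> [::] /\ ~ (exists (v : seq V) (k : nat), 2 <= k /\ w = wpow v k).

Definition insert_letter w (i : nat) a : seq V := take i w ++ a :: drop i w.

Definition ins_robust w : Prop :=
  primitive_word w /\
  (forall (i : nat) a, i <= size w -> primitive_word (insert_letter w i a)).

End Words.

(* The machine model is a random access machine in the style of Cook and
   Reckhow, with unit cost per instruction. Registers are addressed directly,
   and a program mentions only finitely many of them; the memory is addressed
   indirectly, through registers. The arithmetic is addition and truncated
   subtraction. *)
Inductive instr : Type :=
  | OpConst of nat & nat
  | OpAdd of nat & nat & nat
  | OpSub of nat & nat & nat
  | OpRead of nat & nat
  | OpWrite of nat & nat
  | OpJump of nat
  | OpJumpZero of nat & nat
  | OpHalt of bool.

Definition program : Type := seq instr.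

Record config : Type := Config {
  pc : nat;
  regs : nat -> nat;
  mem : nat -> nat
}.

Inductive outcome : Type :=
  | Next of config
  | Answer of bool
  | Stuck.

Definition update (f : nat -> nat) (i x : nat) : nat -> nat :=
  fun j => if j == i then x else f j.

(* B is the largest number that fits in a machine word: writing a larger value
   is a fault, so that unit cost cannot be abused by computing with huge
   numbers. *)
Definition set_reg (B : nat) (c : config) (r x : nat) : outcome :=
  if x <= B then Next (Config (pc c).+1 (update (regs c) r x) (mem c))
  else Stuck.

Definition set_mem (B : nat) (c : config) (addr x : nat) : outcome :=
  if x <= B then Next (Config (pc c).+1 (regs c) (update (mem c) addr x))
  else Stuck.

Definition goto (c : config) (l : nat) : outcome :=
  Next (Config l (regs c) (mem c)).

Definition exec (B : nat) (c : config) (i : instr) : outcome :=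
  match i with
  | OpConst r k => set_reg B c r k
  | OpAdd r s t => set_reg B c r (regs c s + regs c t)
  | OpSub r s t => set_reg B c r (regs c s - regs c t)
  | OpRead r s => set_reg B c r (mem c (regs c s))
  | OpWrite r s => set_mem B c (regs c r) (regs c s)
  | OpJump l => goto c l
  | OpJumpZero r l => goto c (if regs c r == 0 then l else (pc c).+1)
  | OpHalt b => Answer b
  end.

Definition step (B : nat) (P : program) (c : config) : outcome :=
  if onth P (pc c) is Some i then exec B c i else Stuck.

(* [run B P t c = Some b] iff P, started in c, answers b after executing at
   most t instructions (the final OpHalt included). *)
Fixpoint run (B : nat) (P : program) (t : nat) (c : config) : option bool :=
  if t is t'.+1 then
    match step B P c with
    | Next c' => run B P t' c'
    | Answer b => Some b
    | Stuck => None
    end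
  else None.

(* On input w, register 0 holds |w| and memory cell i < |w| holds the rank in
   [enum V] of the i-th letter of w; everything else is 0. *)
Definition init (V : finType) (w : seq V) : config :=
  Config 0 (update (fun=> 0) 0 (size w))
         (nth 0 [seq (enum_rank a : nat) | a <- w]).

(* Words of O(log n) bits: on inputs of length n the values are at most
   (n + 2) ^ c for a constant c. *)
Definition decides_in_time (V : finType) (P : program) (c : nat)
    (T : nat -> nat) (L : seq V -> Prop) : Prop :=
  forall w : seq V, exists b : bool,
    run ((size w + 2) ^ c) P (T (size w)) (init w) = Some b /\ (b <-> L w).

Definition bigO (f g : nat -> nat) : Prop :=
  exists C N : nat, forall n : nat, N <= n -> f n <= C * g n.

(* Main.v *)
Require Import Defs.
From mathcomp Require Import all_boot zify.

(** Let n = |w|. The word w is a power iff it has a period p with p q = n and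
    q >= 2, and some insertion into w is a power iff, for some p q = n + 1 with
    q >= 2, w is a p-periodic word with one letter deleted. Both conditions can
    be tested in constant time per p from the Z-function of w (the longest
    common prefixes of w with its suffixes) and that of the reversal of w: they
    give the longest p-periodic prefix and suffix of w and compare the first p
    letters with the last p letters. The two Z-functions are computed in linear
    time, and all pairs (p, q) with p q in {n, n + 1} are met on a monotone path
    of length O(n) that starts at (1, n + 1), increases p when p q <= n, and
    decreases q otherwise. *)

(** * Structured commands and their weakest preconditions *)

Inductive cmd : Type :=
  | Skip
  | Op of instr
  | Seq of cmd & cmd
  | IfZ of nat & cmd & cmd
  | While of cmd & nat & cmd.

Fixpoint csize (c : cmd) : nat :=
  match c with
  | Skip => 0
  | Op _ => 1
  | Seq c1 c2 => csize c1 + csize c2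
  | IfZ _ c1 c2 => (csize c2 + (csize c1).+1).+1
  | While c1 _ c2 => csize c1 + (csize c2 + 1).+1
  end.

(** Jump targets are absolute, hence the load address [o]. In [IfZ] the code for a nonzero register
    comes first and ends with a jump over the other branch. *)
Fixpoint compile (o : nat) (c : cmd) : program :=
  match c with
  | Skip => [::]
  | Op i => [:: i]
  | Seq c1 c2 => compile o c1 ++ compile (o + csize c1) c2
  | IfZ r c1 c2 =>
      OpJumpZero r (o + csize c2 + 2) :: compile o.+1 c2 ++
      OpJump (o + csize c2 + csize c1 + 2)
        :: compile (o + csize c2 + 2) c1
  | While c1 r c2 =>
      compile o c1 ++
      OpJumpZero r (o + csize c1 + csize c2 + 2)
        :: compile (o + csize c1).+1 c2 ++ [:: OpJump o]
  end.

Lemma size_compile o c : size (compile o c) = csize c.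
Proof.
elim: c o => //= [c1 IH1 c2 IH2|r c1 IH1 c2 IH2|c1 IH1 r c2 IH2] o;
  by rewrite ?size_cat /= ?size_cat IH1 IH2.
Qed.

Section Wp.
Variable B : nat.

Definition post := (nat -> nat) -> (nat -> nat) -> nat -> Prop.

(* The number k is a supply of time credits, one per instruction. *)
Definition wp (c : cmd) (Q : post) (R M : nat -> nat) (k : nat) : Prop :=
  forall (pre suf : program) (F : option bool -> Prop),
    let P := pre ++ compile (size pre) c ++ suf in
    (forall R' M' k', k' <= k -> Q R' M' k' ->
       F (run B P k' (Config (size pre + csize c) R' M'))) ->
    F (run B P k (Config (size pre) R M)).

Lemma onth_mid (pre suf : program) i o :
  o = size pre -> onth (pre ++ i :: suf) o = Some i.
Proof. by move=> ->; elim: pre. Qed.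

Lemma run_instr (P pre suf : program) i o k R M :
  P = pre ++ i :: suf -> o = size pre ->
  run B P k.+1 (Config o R M) =
    match exec B (Config o R M) i with
    | Next c' => run B P k c'
    | Answer b => Some b
    | Stuck => None
    end.
Proof. by move=> -> ->; rewrite /= /step onth_mid. Qed.

Lemma wp_skip (Q : post) R M k : Q R M k -> wp Skip Q R M k.
Proof.
move=> HQ pre suf F P H; move: (H _ _ _ (leqnn k) HQ).
by rewrite addn0.
Qed.

(** The code of [c2] joins the suffix seen by [c1], and that of [c1] the prefix seen by [c2]; this
    is why [wp] quantifies over the surrounding code. *)
Lemma wp_seq c1 c2 Q R M k : wp c1 (wp c2 Q) R M k -> wp (Seq c1 c2) Q R M k.
Proof.
move=> H pre suf F; rewrite /= -catA => HQ.
apply: (H pre) => R' M' k' le_k' {}H.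
have := H (pre ++ compile (size pre) c1) suf F.
rewrite size_cat size_compile -!catA; apply=> R2 M2 k2 le_k2 /HQ.
by rewrite addnA; apply; apply: leq_trans le_k'.
Qed.

(** With the credits written as [k - m], symbolic execution merely increments [m]. *)
Lemma wp_start c Q R M k : wp c Q R M (k - 0) -> wp c Q R M k.
Proof. by rewrite subn0. Qed.

Lemma wp_const (Q : post) r x R M k m : x <= B -> m < k ->
  Q (update R r x) M (k - m.+1) -> wp (Op (OpConst r x)) Q R M (k - m).
Proof.
move=> xB; rewrite -subn_gt0 subnS; case: (k - m) => // {m}k _ HQ pre suf F P H.
rewrite /= /step onth_mid //=.
by rewrite /set_reg xB /=; move: (H _ _ _ (leqnSn k) HQ); rewrite addn1.
Qed.

Lemma wp_add (Q : post) r s t x y R M k m :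
  R s = x -> R t = y -> x + y <= B -> m < k ->
  Q (update R r (x + y)) M (k - m.+1) -> wp (Op (OpAdd r s t)) Q R M (k - m).
Proof.
move=> <- <- xB; rewrite -subn_gt0 subnS; case: (k - m) => // {m}k _ HQ.
move=> pre suf F P H.
rewrite /= /step onth_mid //=.
by rewrite /set_reg xB /=; move: (H _ _ _ (leqnSn k) HQ); rewrite addn1.
Qed.

Lemma wp_sub (Q : post) r s t x y R M k m :
  R s = x -> R t = y -> x - y <= B -> m < k ->
  Q (update R r (x - y)) M (k - m.+1) -> wp (Op (OpSub r s t)) Q R M (k - m).
Proof.
move=> <- <- xB; rewrite -subn_gt0 subnS; case: (k - m) => // {m}k _ HQ.
move=> pre suf F P H.
rewrite /= /step onth_mid //=.
by rewrite /set_reg xB /=; move: (H _ _ _ (leqnSn k) HQ); rewrite addn1.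
Qed.

Lemma wp_read (Q : post) r s x y R M k m :
  R s = x -> M x = y -> y <= B -> m < k ->
  Q (update R r y) M (k - m.+1) -> wp (Op (OpRead r s)) Q R M (k - m).
Proof.
move=> <- <- xB; rewrite -subn_gt0 subnS; case: (k - m) => // {m}k _ HQ.
move=> pre suf F P H.
rewrite /= /step onth_mid //=.
by rewrite /set_reg xB /=; move: (H _ _ _ (leqnSn k) HQ); rewrite addn1.
Qed.

Lemma wp_write (Q : post) r s x y R M k m :
  R r = x -> R s = y -> y <= B -> m < k ->
  Q R (update M x y) (k - m.+1) -> wp (Op (OpWrite r s)) Q R M (k - m).
Proof.
move=> <- <- xB; rewrite -subn_gt0 subnS; case: (k - m) => // {m}k _ HQ.
move=> pre suf F P H.
rewrite /= /step onth_mid //=.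
by rewrite /set_mem xB /=; move: (H _ _ _ (leqnSn k) HQ); rewrite addn1.
Qed.

Lemma wp_ifz (Q : post) r c1 c2 x R M k m : R r = x -> m.+1 < k ->
  (x = 0 -> wp c1 Q R M (k - m.+1)) ->
  (x <> 0 -> wp c2 (fun R' M' k' => 0 < k' /\ Q R' M' k'.-1) R M (k - m.+1)) ->
  wp (IfZ r c1 c2) Q R M (k - m).
Proof.
move=> <- lt_m; have {lt_m} : 1 < k - m by rewrite ltn_subRL addn1.
rewrite subnS; case: (k - m) => // {m}k k0 Hz Hnz pre suf F P H.
have -> : run B P k.+1 (Config (size pre) R M) = run B P k
    (Config (if R r == 0 then size pre + csize c2 + 2 else (size pre).+1) R M).
  by rewrite /= /step onth_mid.
case: eqP => [/Hz|/Hnz] {}H1.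
- set j := OpJumpZero r (size pre + csize c2 + 2).
  set l := OpJump (size pre + csize c2 + csize c1 + 2).
  have := H1 (pre ++ j :: compile (size pre).+1 c2 ++ [:: l]) suf F.
  have E : size (pre ++ j :: compile (size pre).+1 c2 ++ [:: l])
     = size pre + csize c2 + 2.
    by rewrite size_cat /= size_cat size_compile /=; lia.
  have EP : (pre ++ j :: compile (size pre).+1 c2 ++ [:: l]) ++
     compile (size pre + csize c2 + 2) c1 ++ suf = P.
    by rewrite /P /= -!catA /= -!catA /=.
  cbv zeta; rewrite E EP; apply=> R' M' k' le_k' HQ.
  have <- : size pre + csize (IfZ r c1 c2) = size pre + csize c2 + 2 + csize c1.
    by move=> /=; lia.
  by apply: H => //; apply: leqW.
- set j := OpJumpZero r (size pre + csize c2 + 2).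
  set l := OpJump (size pre + csize c2 + csize c1 + 2).
  have := H1 (rcons pre j)
    (l :: compile (size pre + csize c2 + 2) c1 ++ suf) F.
  have EP : rcons pre j ++ compile (size pre).+1 c2 ++
     l :: compile (size pre + csize c2 + 2) c1 ++ suf = P.
    by rewrite /P /= cat_rcons -!catA /=.
  cbv zeta; rewrite size_rcons EP; apply=> R' M' [_ []//|k'] le_k' [_ HQ].
  rewrite catA in EP; rewrite (run_instr _ _ _ _ _ _ _ _ (esym EP)); last first.
    by rewrite size_cat size_rcons size_compile.
  rewrite /= /goto /=.
  have -> : size pre + csize c2 + csize c1 + 2 = size pre + csize (IfZ r c1 c2).
    by move=> /=; lia.
  by apply: H => //; move: le_k' => /=; lia.
Qed.

(* The credits double as the termination measure. *)
Lemma wp_while (I Q : post) c1 r c2 R M k :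
  I R M k ->
  (forall R M k, I R M k -> wp c1 (fun R' M' k' => exists x,
     [/\ R' r = x, 0 < k', x = 0 -> Q R' M' k'.-1
     & x <> 0 -> wp c2 (fun R'' M'' k'' =>
        0 < k'' /\ I R'' M'' k''.-1) R' M' k'.-1]) R M k) ->
  wp (While c1 r c2) Q R M k.
Proof.
move=> HI Hstep pre suf F P H.
elim/ltn_ind: k R M HI H => k IH R M HI H.
set j := OpJumpZero r (size pre + csize c1 + csize c2 + 2).
set l := OpJump (size pre).
have EP : P = pre ++ compile (size pre) c1 ++ j ::
    compile (size pre + csize c1).+1 c2 ++ l :: suf.
  by rewrite /P /= -!catA /= -!catA.
rewrite EP; apply: (Hstep _ _ _ HI) => R' M' [_ [?[]]//|k'] le_k'.
case=> _ [<- _ Hz Hnz].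
rewrite -EP.
have -> : run B P k'.+1 (Config (size pre + csize c1) R' M') = run B P k'
    (Config (if R' r == 0 then size pre + csize c1 + csize c2 + 2
      else (size pre + csize c1).+1) R' M').
  rewrite (run_instr _ _ _ _ _ _ _ _ (etrans EP (catA _ _ _))) //.
  by rewrite size_cat size_compile.
case: eqP => [/Hz|/Hnz] {}H1.
  have -> : size pre + csize c1 + csize c2 + 2
      = size pre + csize (While c1 r c2) by move=> /=; lia.
  by apply: H => //; lia.
have := H1 (pre ++ compile (size pre) c1 ++ [:: j]) (l :: suf) F.
have E : size (pre ++ compile (size pre) c1 ++ [:: j])
    = (size pre + csize c1).+1.
  by rewrite !size_cat size_compile /= addn1 addnS.
have EP' : (pre ++ compile (size pre) c1 ++ [:: j]) ++
     compile (size pre + csize c1).+1 c2 ++ l :: suf = P.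
  by rewrite EP /= -!catA.
cbv zeta; rewrite E EP'; apply=> R2 M2 [_ []//|k2] le_k2 [_ HI2].
rewrite (run_instr _ _ _ _ _ _ _ _ (etrans (esym EP') (catA _ _ _)));
  last first.
  by rewrite size_cat E size_compile.
apply: (IH _ _ R2 M2 HI2) => [|R3 M3 k3 le_k3]; first by move=> /=; lia.
by apply: H; move: le_k3 => /=; lia.
Qed.

End Wp.
Arguments compile : simpl never.
Arguments wp : simpl never.

(** * Powers, insertions and Z-values *)

(* The longest common prefix of f[0..n) and f[i..n) has length z. *)
Definition zval (f : nat -> nat) (n i z : nat) : Prop :=
  [/\ i + z <= n, (forall j, j < z -> f j = f (i + j))
    & i + z < n -> f z <> f (i + z)].

Lemma zval_le f n i z m : zval f n i z ->
  m <= z <-> i + m <= n /\ (forall j, j < m -> f j = f (i + j)).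
Proof.
case=> le_n eq_z neq_z; split=> [le_m|[le_m eq_m]].
  by split=> [|j lt_j]; [lia | apply: eq_z; lia].
by rewrite leqNgt; apply/negP=> lt_z; apply: neq_z; [lia | apply: eq_m].
Qed.

Lemma eq_zval f g n i z :
  (forall j, j < n -> f j = g j) -> zval f n i z -> zval g n i z.
Proof.
move=> fg [le_n eq_z neq_z]; split=> // [j lt_j|lt_n].
  by rewrite -(fg j) -1?(fg (i + j)); [apply: eq_z | lia..].
by rewrite -(fg z) -1?(fg (i + z)); [apply: neq_z | lia..].
Qed.

Lemma eq_modn_period (T : Type) (f : nat -> T) p m :
  (forall j, j + p < m -> f j = f (p + j)) ->
  forall j, j < m -> f j = f (j %% p).
Proof.
move=> per j; elim/ltn_ind: j => j IH lt_m.
have [lt_p|le_p] := ltnP j p; first by rewrite modn_small.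
have [->|p0] := posnP p; first by rewrite modn0.
rewrite -{1}(subnKC le_p) -per; last by lia.
rewrite IH; [|lia..].
by rewrite -{2}(subnK le_p) modnDr.
Qed.

(** Since [n] is [-1] modulo [p], counting a position from the right end mirrors its residue. *)
Lemma modn_subl_pred n p k t :
  0 < p -> k * p = n.+1 -> t <= n -> (n - t) %% p = p.-1 - t %% p.
Proof.
move=> p0 kp le_t.
have lt_r := ltn_pmod t p0; have Et := divn_eq t p.
set q := t %/ p in Et *; set r := t %% p in Et lt_r *.
have -> : n - t = (k.-1 - q) * p + (p.-1 - r).
  rewrite mulnBl -subn1 mulnBl mul1n.
  have : q < k by rewrite -(ltn_pmul2r p0); lia.
  by move=> /(leq_mul (m2 := p))/(_ (leqnn p)); rewrite mulSn; lia.
by rewrite modnMDl modn_small //; lia.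
Qed.

Section Words.
Variable V : finType.
Implicit Types (w v : seq V) (a : V).

Lemma size_wpow v k : size (wpow v k) = k * size v.
Proof. by elim: k => //= k IH; rewrite /wpow /= size_cat -/(wpow v k) IH. Qed.

Lemma nth_wpow x0 v k j : j < k * size v ->
  nth x0 (wpow v k) j = nth x0 v (j %% size v).
Proof.
elim: k j => //= k IH j lt_j; rewrite /wpow /= nth_cat -/(wpow v k).
case: ltnP => [lt_v|le_v]; first by rewrite modn_small.
rewrite IH; last by move: lt_j; rewrite mulSn; lia.
by rewrite -{2}(subnK le_v) modnDr.
Qed.

Lemma size_insert_letter w i a : size (insert_letter w i a) = (size w).+1.
Proof.
by rewrite /insert_letter size_cat /= addnS -size_cat cat_take_drop.
Qed.

Lemma nth_insert_letter x0 w i a j : i <= size w ->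
  nth x0 (insert_letter w i a) j =
  if j < i then nth x0 w j else if j == i then a else nth x0 w j.-1.
Proof.
move=> le_i; rewrite nth_cat size_takel //; case: ltnP => [|le_j].
  by move=> lt_j; rewrite nth_take.
case: eqP => [->|ne_j]; first by rewrite subnn.
have -> : j - i = (j - i).-1.+1 by lia.
by rewrite /= nth_drop; congr nth; lia.
Qed.

(** Letters before the insertion keep their residue; those after it are counted from the right end,
    where the insertion does not shift them and a copy of [v] ends. *)
Lemma insert_letter_wpow x0 w i a v k : i <= size w ->
  k * size v = (size w).+1 ->
  insert_letter w i a = wpow v k <->
  [/\ forall j, j < i -> nth x0 w j = nth x0 v (j %% size v),
      a = nth x0 v (i %% size v)
    & forall t, t < size w - i ->
        nth x0 w ((size w).-1 - t) = nth x0 v ((size v).-1 - t %% size v)].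
Proof.
move=> le_i kp.
have p0 : 0 < size v by lia.
split=> [E|[Hpre Ha Hsuf]].
  have H j : j <= size w -> nth x0 (insert_letter w i a) j
      = nth x0 v (j %% size v).
    by move=> le_j; rewrite E nth_wpow // kp.
  split=> [j lt_j||t lt_t].
  - by rewrite -H ?nth_insert_letter ?lt_j //; lia.
  - by rewrite -H // nth_insert_letter // ltnn eqxx.
  - rewrite -(modn_subl_pred _ _ _ _ p0 kp) -?H ?nth_insert_letter //; try lia.
    by do 2?case: ifP => ?; try lia; congr nth; lia.
apply: (@eq_from_nth _ x0) => [|j]; rewrite size_insert_letter.
  by rewrite size_wpow kp.
move=> lt_j; rewrite nth_wpow ?kp // nth_insert_letter //.
case: ltnP => [/Hpre //|le_j]; case: eqP => [->//|ne_j].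
have Ej : j = size w - (size w - j) by lia.
rewrite {2}Ej (modn_subl_pred _ _ _ _ p0 kp) -?Hsuf; try lia.
by congr nth; lia.
Qed.

(** By periodicity, [p + Z p] and [p + ZR p] are the lengths of the longest [p]-periodic prefix and
    suffix of the word; [ZR (n - p)] is how far its end agrees with the end of its first [p]
    letters, and [Z (n - p)] how far its start agrees with its last [p] letters. *)
Definition ins_test (n : nat) (Z ZR : nat -> nat) (p : nat) : bool :=
  [|| n <= p + Z p + ZR (n - p), n <= Z (n - p) + (p + ZR p)
    | (p <= ZR (n - p)) && (n <= p + Z p + (p + ZR p))].

Section Tests.
Variables (x0 : V) (w : seq V) (f Z ZR : nat -> nat).
Let n := size w.
Hypothesis fw : forall i j, i < n -> j < n ->
  f i = f j <-> nth x0 w i = nth x0 w j.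
Hypothesis HZ : forall i, i <= n -> zval f n i (Z i).
Hypothesis HZR : forall i, i <= n -> zval (fun j => f (n.-1 - j)) n i (ZR i).

Let g := nth x0 w.
Let gr t := g (n.-1 - t).

Let ZP i m : i <= n ->
  m <= Z i <-> i + m <= n /\ (forall j, j < m -> g j = g (i + j)).
Proof.
move=> le_i; rewrite (zval_le _ _ _ _ m (HZ _ le_i)).
by split=> -[le_m H]; split=> // j lt_j; apply/fw; try lia; apply: H.
Qed.

Let ZRP i m : i <= n ->
  m <= ZR i <-> i + m <= n /\ (forall j, j < m -> gr j = gr (i + j)).
Proof.
move=> le_i; rewrite (zval_le _ _ _ _ m (HZR _ le_i)).
by split=> -[le_m H]; split=> // j lt_j; apply/fw; try lia; apply: H.
Qed.

Let prefix_period p : p <= n ->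
  p + Z p <= n /\ forall j, j < p + Z p -> g j = g (j %% p).
Proof.
move=> le_p; have [le_n H] := (ZP p (Z p) le_p).1 (leqnn _).
by split=> //; apply: eq_modn_period => j lt_j; apply: H; lia.
Qed.

Let suffix_period p : p <= n ->
  p + ZR p <= n /\ forall j, j < p + ZR p -> gr j = gr (j %% p).
Proof.
move=> le_p; have [le_n H] := (ZRP p (ZR p) le_p).1 (leqnn _).
by split=> //; apply: eq_modn_period => j lt_j; apply: H; lia.
Qed.

Lemma power_testP p k : 0 < n -> 1 < k -> p * k = n ->
  n <= p + Z p <-> exists v, w = wpow v k.
Proof.
move=> n0 k1 pk; have p0 : 0 < p by lia.
have le_p : p <= n by rewrite -pk leq_pmulr // ltnW.
split=> [le_n|[v E]].
  exists (take p w).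
  have Ep : size (take p w) = p by rewrite size_takel.
  apply: (@eq_from_nth _ x0) => [|j lt_j].
    by rewrite size_wpow Ep mulnC pk.
  rewrite nth_wpow ?Ep 1?mulnC ?pk // nth_take ?ltn_pmod //.
  by apply: (prefix_period p le_p).2; apply: leq_trans le_n.
have Ep : size v = p.
  have := congr1 size E; rewrite size_wpow -[size w]/n -pk mulnC => /eqP.
  by rewrite eqn_pmul2l ?(ltnW k1) // => /eqP.
suff : n - p <= Z p by lia.
apply/ZP => //; split=> [|j lt_j]; first by lia.
rewrite /g E !nth_wpow Ep ?modnDl // mulnC pk //; lia.
Qed.

(* If the letter is inserted at position i, the prefix and the suffix of w cut
   at i are p-periodic and at least one of them is as long as p. The period is
   then read off at the start or at the end of w, and the three disjuncts of
   the test are the cases p <= i, p <= n - i, and both. *)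
Lemma ins_testP p k : 1 < k -> p * k = n.+1 ->
  ins_test n Z ZR p <->
  exists i a v, i <= n /\ insert_letter w i a = wpow v k.
Proof.
move=> k1 pk.
have p0 : 0 < p by lia.
(* Since [k >= 2], a cut at [i < p] leaves at least [p] letters on its right. *)
have lt_p : p.*2 <= n.+1 by rewrite -pk -muln2 leq_pmul2l.
have le_p : p <= n by lia.
have le_np : n - p <= n by lia.
split=> [|[i [a [v [le_i E]]]]].
- have [leA perA] := prefix_period p le_p.
  have [leB perB] := suffix_period p le_p.
  have [leal eqal] := (ZP (n - p) (Z (n - p)) le_np).1 (leqnn _).
  have [lebe eqbe] := (ZRP (n - p) (ZR (n - p)) le_np).1 (leqnn _).
  have szt : size (take p w) = p by rewrite size_takel.
  have szd : size (drop (n - p) w) = p by rewrite size_drop -/n; lia.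
  have ltr t : t %% p < p by rewrite ltn_pmod.
  have gt t : nth x0 (take p w) (p.-1 - t %% p) = g (p.-1 - t %% p).
    by rewrite nth_take //; lia.
  case/or3P => [le1|le2|/andP[le3 le4]].
  (* The root is the first [p] letters; the insertion comes just before the longest suffix that
     matches the end of this root. *)
  + exists (n - ZR (n - p)), (nth x0 (take p w) ((n - ZR (n - p)) %% p)).
    exists (take p w); split; first by lia.
    apply/(insert_letter_wpow x0); rewrite -/n ?szt; try lia.
    split=> // [j lt_j|t lt_t].
      by rewrite nth_take //; apply: perA; lia.
    rewrite gt -[nth x0 w _]/(gr t) eqbe; last by lia.
    by rewrite /gr modn_small; [congr g | ]; lia.
  (* Mirror image, with the last [p] letters as root. *)
  + exists (Z (n - p)), (nth x0 (drop (n - p) w) (Z (n - p) %% p)).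
    exists (drop (n - p) w); split; first by lia.
    apply/(insert_letter_wpow x0); rewrite -/n ?szd; try lia.
    split=> // [j lt_j|t lt_t]; rewrite nth_drop.
      by rewrite modn_small; [apply: eqal | lia].
    rewrite -[nth x0 w (n.-1 - t)]/(gr t) perB; last by lia.
    by rewrite /gr; congr g; have := ltr t; lia.
  (* The insertion follows the longest [p]-periodic prefix; what remains lies in the periodic
     suffix, and [le3] says that the first and the last [p] letters coincide. *)
  + exists (p + Z p), (nth x0 (take p w) ((p + Z p) %% p)), (take p w).
    split=> //.
    apply/(insert_letter_wpow x0); rewrite -/n ?szt; try lia.
    split=> // [j lt_j|t lt_t].
      by rewrite nth_take //; apply: perA; lia.
    rewrite gt -[nth x0 w _]/(gr t) perB; last by lia.
    rewrite eqbe; last by apply: leq_trans le3; apply: ltr.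
    by rewrite /gr; congr g; have := ltr t; lia.
- have szv : size v = p.
    have := congr1 size E; rewrite size_wpow size_insert_letter.
    rewrite -[size w]/n -pk mulnC => /eqP.
    by rewrite eqn_pmul2l ?(ltnW k1) // => /eqP.
  have kp : k * size v = n.+1 by rewrite szv mulnC.
  have [Hpre _ Hsuf] := (insert_letter_wpow x0 w i a v k le_i kp).1 E.
  rewrite szv in Hpre Hsuf.
  have HA : p <= i -> i - p <= Z p.
    move=> le_pi; apply/ZP => //; split=> [|j lt_j]; first by lia.
    by rewrite /g !Hpre ?modnDl //; lia.
  have HB : p <= n - i -> n - i - p <= ZR p.
    move=> le_pi; apply/ZRP => //; split=> [|j lt_j]; first by lia.
    by rewrite /gr /g !Hsuf ?modnDl //; lia.
  (* A side of length at least [p] puts a full copy of [v] at its end of [w]; the other end is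
     compared with this copy. *)
  have Hbe m : p <= i -> m <= p -> m <= n - i -> m <= ZR (n - p).
    move=> le_pi le_m le_m'; apply/ZRP => //; split=> [|j lt_j]; first by lia.
    rewrite /gr /g Hsuf; last by lia.
    have -> : n.-1 - (n - p + j) = p.-1 - j by lia.
    by rewrite Hpre ?(@modn_small j) ?(@modn_small (_ - _)) //; lia.
  have Hal : p <= n - i -> i <= p -> i <= Z (n - p).
    move=> le_pi le_m; apply/ZP => //; split=> [|j lt_j]; first by lia.
    rewrite /g Hpre //.
    have -> : n - p + j = n.-1 - (p.-1 - j) by lia.
    rewrite Hsuf; last by lia.
    by rewrite ?(@modn_small j) ?(@modn_small (_ - _)) //; [congr nth|..]; lia.
  apply/or3P; have [le_pi|lt_pi] := leqP p i.
    have := HA le_pi; have [le_pn|lt_pn] := leqP p (n - i).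
      by move=> ?; apply: Or33; have := HB le_pn; have := Hbe p le_pi; lia.
    by move=> ?; apply: Or31; have := Hbe (n - i) le_pi; lia.
  by apply: Or32; have := HB; have := Hal; lia.
Qed.

Lemma ins_robustP : ins_robust w <->
  ~ (n = 0 \/ exists p k, 1 < k /\
      (p * k = n /\ n <= p + Z p \/ p * k = n.+1 /\ ins_test n Z ZR p)).
Proof.
split.
  case=> -[wN prim] rob [n0|[p [k [k1 H]]]].
    by apply: wN; apply: size0nil.
  have n0 : 0 < n by rewrite lt0n; apply/eqP=> n0; apply/wN/size0nil.
  case: H => [[pk /(power_testP _ _ n0 k1 pk)[v E]]|[pk]].
    by apply: prim; exists v, k.
  case/(ins_testP _ _ k1 pk) => i [a [v [le_i E]]].
  by apply: (rob i a le_i).2; exists v, k.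
move=> H.
have n0 : 0 < n by rewrite lt0n; apply/eqP=> ?; apply: H; left.
split.
  split=> [w0|[v [k [k1 E]]]]; first by move: n0; rewrite /n w0.
  apply: H; right; exists (size v), k; split=> //; left.
  have pk : size v * k = n by rewrite /n E size_wpow mulnC.
  by split=> //; apply/(power_testP _ _ n0 k1 pk); exists v.
move=> i a le_i; split=> [E|[v [k [k1 E]]]].
  by have := size_insert_letter w i a; rewrite E.
apply: H; right; exists (size v), k; split=> //; right.
have pk : size v * k = n.+1.
  by rewrite mulnC -size_wpow -E size_insert_letter.
by split=> //; apply/(ins_testP _ _ k1 pk); exists i, a, v.
Qed.

End Tests.
End Words.

(** * The Z-algorithm *)

Definition seqs : seq cmd -> cmd := foldr Seq Skip.

Ltac regs_simpl :=
  rewrite /update /=;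
  repeat match goal with
  | H : ?R ?c = _ |- context [?R ?c] => rewrite H
  end.

Ltac eval_reg := regs_simpl; reflexivity.

Ltac side :=
  repeat match goal with H : _ <-> _ |- _ => clear H end;
  first [ done | lia ].

Ltac exec1 :=
  lazymatch goal with
  | |- wp _ (Seq _ _) _ _ _ _ => apply: wp_seq
  | |- wp _ Skip _ _ _ _ => apply: wp_skip
  | |- wp _ (Op (OpConst _ _)) _ _ _ _ => apply: wp_const; [side | side | ]
  | |- wp _ (Op (OpAdd _ _ _)) _ _ _ _ =>
      eapply wp_add; [eval_reg | eval_reg | side | side | ]
  | |- wp _ (Op (OpSub _ _ _)) _ _ _ _ =>
      eapply wp_sub; [eval_reg | eval_reg | side | side | ]
  | |- wp _ (Op (OpRead _ _)) _ _ _ _ =>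
      eapply wp_read; [eval_reg | eval_reg | side | side | ]
  | |- wp _ (Op (OpWrite _ _)) _ _ _ _ =>
      eapply wp_write; [eval_reg | eval_reg | side | side | ]
  end.

Ltac exec_ops :=
  rewrite /seqs /= -?subnS;
  try match goal with
  | |- wp _ _ _ _ _ (_ - _) => idtac
  | |- wp _ _ _ _ _ _ => apply: wp_start
  end;
  repeat exec1.

Ltac eval_exit := eexists; split; [eval_reg | lia | | ].

(* Register 0 holds n and register 1 holds 1 throughout. Here 2 and 3 hold the
   addresses of the text and of its table of Z-values, 4 the current position
   i, 5 and 6 the window [l, r) that matches a prefix of the text, and 7 the
   value z under construction. *)
Definition zmatch : cmd :=
  seqs [:: Op (OpAdd 9 4 7); Op (OpSub 8 0 9);
    IfZ 8 Skip
      (seqs [:: Op (OpAdd 10 2 7); Op (OpRead 10 10);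
                Op (OpAdd 11 2 9); Op (OpRead 11 11);
                Op (OpSub 12 10 11); Op (OpSub 11 11 10); Op (OpAdd 12 12 11);
                Op (OpSub 8 1 12)])].

(** The guard leaves 0 at the end of the text and otherwise [1 - |a - b|], truncated, for the two
    letters: the loop goes on exactly while they agree. *)
Definition zextend : cmd := While zmatch 8 (Op (OpAdd 7 7 1)).

(** With truncated subtraction [x - (x - y)] is [minn x y]; the extension thus starts from the
    minimum of the entry at [i - l] and [r - i]. *)
Definition zbody : cmd :=
  seqs [:: Op (OpSub 7 4 5); Op (OpAdd 7 3 7); Op (OpRead 7 7);
    Op (OpSub 8 6 4); Op (OpSub 9 7 8); Op (OpSub 7 7 9);
    zextend;
    Op (OpAdd 9 4 7); Op (OpSub 8 9 6);
    IfZ 8 Skip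
      (seqs [:: Op (OpConst 10 0); Op (OpAdd 5 4 10); Op (OpAdd 6 9 10)]);
    Op (OpAdd 9 3 4); Op (OpWrite 9 7); Op (OpAdd 4 4 1)].

(** The entry at 0 is [n]. The initial window [[1, 0)] is empty, and [l = 1] keeps [i - l] among the
    entries already filled. *)
Definition zfunc : cmd :=
  seqs [:: Op (OpWrite 3 0); Op (OpConst 4 1); Op (OpConst 5 1);
    Op (OpConst 6 0);
    While (seqs [:: Op (OpAdd 8 0 1); Op (OpSub 8 8 4)]) 8 zbody].

Section Zfunc.
Variables (B n tb zb : nat).
Hypothesis leB : zb + n + n + 2 <= B.
Hypothesis le_zb : tb + n <= zb.

(* If i + z < r then the extension stops at once, so every successful comparison
   increases the maximum of r and i + z, which pays for it. *)
Lemma wp_zextend (f : nat -> nat) i l r z (Q : post) R M k c :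
  R 0 = n -> R 1 = 1 -> R 2 = tb -> R 3 = zb ->
  R 4 = i -> R 5 = l -> R 6 = r -> R 7 = z ->
  (forall j, j < n -> M (tb + j) = f j) -> (forall j, j < n -> f j <= B) ->
  i + z <= n -> r <= n -> (forall j, j < z -> f j = f (i + j)) ->
  (i + z < r -> f z <> f (i + z)) ->
  20 * (n - maxn r (i + z)) + c + 20 <= k ->
  (forall R' k' z', R' 0 = n -> R' 1 = 1 -> R' 2 = tb -> R' 3 = zb ->
     R' 4 = i -> R' 5 = l -> R' 6 = r -> R' 7 = z' -> zval f n i z' ->
     20 * (n - maxn r (i + z')) + c <= k' -> Q R' M k') ->
  wp B zextend Q R M k.
Proof.
move=> R0 R1 R2 R3 R4 R5 R6 R7 Mf fB le_n le_r eq_z neq_z le_k HQ.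
apply: (wp_while B (fun R M' k => M' = M /\ exists z,
  ([/\ R 0 = n, R 1 = 1, R 2 = tb & R 3 = zb] /\
   [/\ R 4 = i, R 5 = l, R 6 = r & R 7 = z]) /\
  [/\ i + z <= n, (forall j, j < z -> f j = f (i + j)),
     (i + z < r -> f z <> f (i + z)) &
     20 * (n - maxn r (i + z)) + c + 20 <= k])).
  by split=> //; exists z; do !split.
move=> {R0 R1 R2 R3 R4 R5 R6 R7 le_n eq_z neq_z le_k z} {}R M' {}k.
case=> -> {M'} [z [[[R0 R1 R2 R3] [R4 R5 R6 R7]] [le_n eq_z neq_z le_k]]].
rewrite /zmatch; exec_ops.
eapply wp_ifz; [eval_reg | lia | |] => Hn.
- exec_ops; eval_exit => // _.
  apply: (HQ _ _ z) => //; last by lia.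
  by split=> //; lia.
- have Ez : M (tb + z) = f z by apply: Mf; lia.
  have Eiz : M (tb + (i + z)) = f (i + z) by apply: Mf; lia.
  have Bz : f z <= B by apply: fB; lia.
  have Biz : f (i + z) <= B by apply: fB; lia.
  exec_ops; split; [lia | exec_ops].
  eval_exit => Hd.
    apply: (HQ _ _ z) => //; last by lia.
    by split=> // _; lia.
  have Efz : f z = f (i + z) by lia.
  clear Hd.
  have le_iz : r <= i + z by rewrite leqNgt; apply/negP=> /neq_z.
  exec_ops; split; first by lia.
  split=> //; exists z.+1; do !split; regs_simpl; rewrite ?addn1 ?addnS //;
    try lia.
  + by move=> j; rewrite ltnS leq_eqVlt => /predU1P[->//|/eq_z].
Qed.

Lemma wp_zfunc (Q : post) R M k c :
  R 0 = n -> R 1 = 1 -> R 2 = tb -> R 3 = zb ->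
  (forall j, j < n -> M (tb + j) <= B) ->
  80 * n + c + 100 <= k ->
  (forall R' M' k', R' 0 = n -> R' 1 = 1 ->
     (forall x, x < zb -> M' x = M x) ->
     (forall i, i <= n -> zval (fun j => M (tb + j)) n i (M' (zb + i))) ->
     c <= k' -> Q R' M' k') ->
  wp B zfunc Q R M k.
Proof.
move=> R0 R1 R2 R3 MB le_k HQ.
set f := fun j => M (tb + j).
rewrite /zfunc; exec_ops.
(* Successful comparisons are paid by [20 * (n - r)], the remaining work at each position by
   [60 * (n.+1 - i)]. *)
apply: (wp_while B (fun R M' k => exists i l r,
  [/\ R 0 = n, R 1 = 1, R 2 = tb & R 3 = zb] /\
  [/\ R 4 = i, R 5 = l & R 6 = r] /\
  [/\ 1 <= l, l <= i, i <= n.+1 & r <= n] /\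
  [/\ (forall x, x < zb -> M' x = M x),
      (forall j, j < i -> zval f n j (M' (zb + j))),
      (forall j, l + j < r -> f j = f (l + j)) &
      20 * (n - r) + 60 * (n.+1 - i) + c + 10 <= k])).
  exists 1, 1, 0; split; [|split; [|split]]; split; regs_simpl => //;
    try lia.
  + by move=> x lt_x; case: eqP => //; lia.
  + move=> j lt_j; have -> : j = 0 by lia.
    by rewrite addn0 eqxx; split=> //; lia.
move=> {R0 R1 R2 R3 le_k} {}R M' {}k [i [l [r]]].
case=> -[R0 R1 R2 R3] [[R4 R5 R6] [[l0 le_l le_i le_r] [fr HZ win le_k]]].
exec_ops; eval_exit => Hi.
  by exec_ops; apply: HQ => //; [move=> j le_j; apply: HZ; lia | lia].
have [le_il eq_il neq_il] := HZ (i - l) ltac:(lia).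
set z := M' (zb + (i - l)) in le_il eq_il neq_il *.
have zB : z <= B by lia.
rewrite /zbody; exec_ops; rewrite -/z.
apply: (wp_zextend f i l r (minn z (r - i)) _ _ _ _
   (60 * (n - i) + c + 40)); regs_simpl => //.
all: try lia.
all: try by move=> j lt_j; rewrite ?fr; [|lia]; rewrite ?MB.
- move=> j lt_j; rewrite eq_il; last by lia.
  rewrite win; last by lia.
  by congr f; lia.
(* Short of [r] the start value is the entry at [i - l], and the window carries the mismatch that
   ends it over to [i]. *)
- move=> lt_r; have -> : minn z (r - i) = z by lia.
  have -> : f (i + z) = f (l + (i - l + z)) by congr f; lia.
  by rewrite -win; [apply: neq_il|]; lia.
move=> {R0 R1 R2 R3 R4 R5 R6 le_k Hi eq_il neq_il le_il zB z} {}R {}k z.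
move=> R0 R1 R2 R3 R4 R5 R6 R7 Hz le_k.
have [le_n eq_z neq_z] := Hz.
have Z' j : j < i.+1 -> zval f n j (update M' (zb + i) z (zb + j)).
  rewrite /update eqn_add2l ltnS leq_eqVlt => /predU1P[->|lt_j].
    by rewrite eqxx.
  by rewrite ltn_eqF //; apply: HZ.
have fr' x : x < zb -> update M' (zb + i) z x = M x.
  by move=> lt_x; rewrite /update; case: eqP => [|_]; [lia | apply: fr].
exec_ops.
eapply wp_ifz; [eval_reg | lia | |] => Hr; exec_ops.
- split; first by lia.
  exists i.+1, l, r; split; [|split; [|split]]; split; regs_simpl;
    rewrite ?addn1 //; lia.
- split; [lia | exec_ops]; split; first by lia.
  exists i.+1, i, (i + z); split; [|split; [|split]]; split; regs_simpl;
    rewrite ?addn1 ?addn0 //; try lia.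
  by move=> j; rewrite ltn_add2l; apply: eq_z.
Qed.
End Zfunc.

(** * Reversal and enumeration of factorizations *)

Definition revcopy : cmd :=
  seqs [:: Op (OpConst 6 0); Op (OpAdd 4 0 6); Op (OpAdd 5 0 1);
    While Skip 4
      (seqs [:: Op (OpSub 4 4 1); Op (OpRead 6 4); Op (OpWrite 5 6);
                Op (OpAdd 5 5 1)])].

Lemma wp_revcopy B n (Q : post) R M k c :
  n + n + 2 <= B ->
  R 0 = n -> R 1 = 1 -> (forall j, j < n -> M j <= B) ->
  10 * n + c + 10 <= k ->
  (forall R' M' k', R' 0 = n -> R' 1 = 1 ->
     (forall x, x < n -> M' x = M x) ->
     (forall t, t < n -> M' (n.+1 + t) = M (n.-1 - t)) ->
     c <= k' -> Q R' M' k') ->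
  wp B revcopy Q R M k.
Proof.
move=> leB R0 R1 MB le_k HQ.
rewrite /revcopy; exec_ops.
apply: (wp_while B (fun R M' k => exists i,
  [/\ R 0 = n, R 1 = 1, R 4 = i & R 5 = n.+1 + (n - i)] /\
  [/\ i <= n, (forall x, x < n -> M' x = M x),
      (forall t, t < n - i -> M' (n.+1 + t) = M (n.-1 - t)) &
      10 * i + c + 5 <= k])).
  exists n; split; split; regs_simpl; rewrite ?subnn ?addn1 ?addn0 //; lia.
move=> {R0 R1 le_k} {}R M' {}k [i [[R0 R1 R4 R5] [le_i M1 M2 le_k]]].
exec_ops; eval_exit => Hi.
  by exec_ops; apply: HQ => // [t lt_t|]; [apply: M2 | ]; lia.
have Mi : M' (i - 1) = M (i - 1) by apply: M1; lia.
have BM : M (i - 1) <= B by apply: MB; lia.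
exec_ops; split; first by lia.
exists (i - 1); split; split; regs_simpl; rewrite ?addn1 //; try lia.
- by move=> x lt_x; case: eqP => [|_]; [lia | apply: M1].
- move=> t lt_t; rewrite eqn_add2l; case: eqP => [->|ne_t].
    by congr M; lia.
  by apply: M2; lia.
Qed.

Definition clear_if_zero : cmd :=
  seqs [:: Op (OpSub 16 1 16); Op (OpSub 2 2 16)].

Lemma wp_clear_if_zero B (Q : post) R M k m g x :
  R 1 = 1 -> R 2 = g -> R 16 = x -> g <= 1 -> 0 < B -> m.+1 < k ->
  (forall g', g' <= 1 -> (g' = 0 <-> g = 0 \/ x = 0) ->
     Q (update (update R 16 (1 - x)) 2 g') M (k - m.+2)) ->
  wp B clear_if_zero Q R M (k - m).
Proof.
move=> R1 R2 R16 le_g B0 lt_k HQ; rewrite /clear_if_zero; exec_ops.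
by apply: HQ; lia.
Qed.

(* Register 2 is the answer, 3 and 4 hold p and q, 5 their product, 6 holds
   n + 1, and 7 and 8 are the addresses of the two tables of Z-values.
   Then 9 and 10 receive |n + 1 - pq| and |n - pq|, which disable the tests that
   do not apply to (p, q) since a test succeeds when its value is 0; 11, 12, 14
   and 15 receive p + Z p, p + ZR p, Z (n - p) and ZR (n - p). *)
Definition pair_load : cmd :=
  seqs [:: Op (OpSub 9 6 5); Op (OpSub 10 5 6); Op (OpAdd 9 9 10);
    Op (OpSub 10 0 5); Op (OpSub 11 5 0); Op (OpAdd 10 10 11);
    Op (OpAdd 11 7 3); Op (OpRead 11 11); Op (OpAdd 11 11 3);
    Op (OpAdd 12 8 3); Op (OpRead 12 12); Op (OpAdd 12 12 3);
    Op (OpSub 13 0 3); Op (OpAdd 14 7 13); Op (OpRead 14 14);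
    Op (OpAdd 15 8 13); Op (OpRead 15 15)].

(** [n - x] vanishes when [n <= x], and a sum when all its terms do, so each block is a conjunction:
    first the power test, then the three disjuncts of [ins_test]. *)
Definition pair_check : cmd :=
  seqs [:: Op (OpSub 16 0 11); Op (OpAdd 16 16 10); clear_if_zero;
    Op (OpAdd 16 11 15); Op (OpSub 16 0 16); Op (OpAdd 16 16 9);
    clear_if_zero;
    Op (OpAdd 16 14 12); Op (OpSub 16 0 16); Op (OpAdd 16 16 9);
    clear_if_zero;
    Op (OpAdd 16 11 12); Op (OpSub 16 0 16); Op (OpSub 17 3 15);
    Op (OpAdd 16 16 17); Op (OpAdd 16 16 9); clear_if_zero].

Definition pair_test : cmd := Seq pair_load pair_check.

Definition pair_step : cmd :=
  seqs [:: Op (OpSub 9 5 0);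
    IfZ 9 (seqs [:: Op (OpAdd 3 3 1); Op (OpAdd 5 5 4)])
          (seqs [:: Op (OpSub 4 4 1); Op (OpSub 5 5 3)])].

Definition pair_loop : cmd :=
  While (Op (OpSub 9 4 1)) 9 (Seq pair_test pair_step).

Section PairLoop.
Variables (B n zb zrb : nat) (M : nat -> nat).
Let Z i := M (zb + i).
Let ZR i := M (zrb + i).
Hypothesis leB : zb + zrb + 9 * n + 9 <= B.
Hypothesis ZB : forall i, i <= n -> Z i <= n.
Hypothesis ZRB : forall i, i <= n -> ZR i <= n.

Definition bad_pair (p q : nat) : Prop :=
  p * q = n /\ n <= p + Z p \/ p * q = n.+1 /\ ins_test n Z ZR p.

Definition loop_regs (R : nat -> nat) (p q : nat) : Prop :=
  [/\ R 0 = n, R 1 = 1, R 3 = p & R 4 = q] /\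
  [/\ R 5 = p * q, R 6 = n.+1, R 7 = zb & R 8 = zrb].

Lemma wp_pair_test (Q : post) R k c p q :
  loop_regs R p q -> R 2 <= 1 -> p <= n -> p * q <= n + n + 1 ->
  c + 40 <= k ->
  (forall R' k', loop_regs R' p q -> R' 2 <= 1 ->
     (R' 2 = 0 <-> R 2 = 0 \/ bad_pair p q) -> c <= k' -> Q R' M k') ->
  wp B pair_test Q R M k.
Proof.
case=> -[R0 R1 R3 R4] [R5 R6 R7 R8]; move E2 : (R 2) => g le_g le_p le_pq le_k.
move=> HQ; have le_np : n - p <= n by lia.
move: (ZB p le_p) (ZRB p le_p) (ZB _ le_np) (ZRB _ le_np).
rewrite /bad_pair /ins_test /Z /ZR in HQ *.
move Ea : (M (zb + p)) HQ => a; move Eb : (M (zrb + p)) => b.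
move Ec : (M (zb + (n - p))) => a'; move Ed : (M (zrb + (n - p))) => b'.
move Epq : (p * q) le_pq R5 => pq le_pq R5 HQ Ba Bb Ba' Bb'.
rewrite /pair_test /pair_load; exec_ops.
move Ed1 : (n.+1 - pq + (pq - n.+1)) => d1.
move Ed0 : (n - pq + (pq - n)) => d0.
have [Bd1 Bd0] : d1 <= n + n + 2 /\ d0 <= n + n + 2 by lia.
have [Hd1 Hd0] : (d1 = 0 <-> pq = n.+1) /\ (d0 = 0 <-> pq = n) by lia.
clear Ed1 Ed0.
rewrite /pair_check; exec_ops.
eapply wp_clear_if_zero;
  [eval_reg | eval_reg | eval_reg | side | side | side |].
intros g1 le_g1 Hg1; exec_ops.
eapply wp_clear_if_zero;
  [eval_reg | eval_reg | eval_reg | side | side | side |].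
intros g2 le_g2 Hg2; exec_ops.
eapply wp_clear_if_zero;
  [eval_reg | eval_reg | eval_reg | side | side | side |].
intros g3 le_g3 Hg3; exec_ops.
eapply wp_clear_if_zero;
  [eval_reg | eval_reg | eval_reg | side | side | side |].
intros g4 le_g4 Hg4; exec_ops.
apply: HQ; [by split; split; regs_simpl | by [] | | side].
regs_simpl.
rewrite Hg4 Hg3 Hg2 Hg1 => {Hg4 Hg3 Hg2 Hg1}.
have zeroE x d : n - x + d = 0 <-> d = 0 /\ n <= x by clear; lia.
have zeroE2 x y d : n - x + (p - y) + d = 0 <-> d = 0 /\ p <= y /\ n <= x.
  by clear; lia.
have orE (x y u v : bool) : [|| x, y | u && v] <-> x \/ y \/ u /\ v.
  by clear; lia.
rewrite zeroE2 !zeroE Hd1 Hd0 orE (addnC p a) (addnC p b).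
by clear; tauto.
Qed.

(* Along the path p + 1 if pq <= n, q - 1 otherwise, a pair with product n or
   n + 1 is never overtaken: the pairs behind (p, q), those with p' < p or
   q < q', have all been tested. *)
Lemma wp_pair_loop (Q : post) R k c :
  loop_regs R 1 n.+1 -> R 2 <= 1 -> (R 2 = 0 <-> n = 0) ->
  200 * n + c + 200 <= k ->
  (forall R' k', R' 2 <= 1 ->
     (R' 2 = 0 <-> n = 0 \/ exists p q, 1 < q /\ bad_pair p q) ->
     c <= k' -> Q R' M k') ->
  wp B pair_loop Q R M k.
Proof.
move=> HR le_g Hg le_k HQ.
apply: (wp_while B (fun R M' k => M' = M /\ exists p q,
  [/\ loop_regs R p q, R 2 <= 1 &
    (R 2 = 0 <-> n = 0 \/ exists p' q',
       1 < q' /\ (p' < p \/ q < q') /\ bad_pair p' q')] /\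
  (* The bound on the product survives a step to [p + 1], taken only if [p * q <= n]; [maxn n 1]
     covers [n = 0], where [p] starts above [n]. *)
  [/\ 0 < p, p <= maxn n 1, 0 < q, q <= n.+1 & p * q <= n + n + 1] /\
  100 * (n - p + q) + c + 10 <= k)).
  split=> //; exists 1, n.+1; split; last by split; [split; lia | lia].
  split=> //; rewrite Hg; split=> [->|[//|[p [q [q1 [lt]]]]]]; first by left.
  have : p * q = 0 \/ n.+1 < p * q by case: p lt => [|p]; rewrite ?mulSn; lia.
  by move=> lt' [] [pq _]; lia.
move=> {HR le_g Hg le_k} {}R M' {}k [-> {M'}] [p [q]].
case=> -[HR le_g Hg] [[p0 le_p q0 le_q le_pq] le_k].
have [[R0 R1 R3 R4] [R5 R6 R7 R8]] := HR.
exec_ops; eval_exit => Hq.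
  apply: HQ; [by regs_simpl | | side].
  regs_simpl; rewrite Hg; split=> -[n0|[p' [q' []]]]; try by left.
    by move=> q1 [_ bad]; right; exists p', q'.
  by move=> q1 bad; right; exists p', q'; do !split=> //; right; lia.
have q1 : 1 < q by lia.
have {le_p}le_p : p <= n by lia.
apply: wp_seq; rewrite -subnS.
apply: (wp_pair_test _ _ _ (100 * (n - p + q) + c - 40) p q) => //; try side.
move=> {HR le_g R0 R1 R3 R4 R5 R6 R7 R8} {}R' {}k HR le_g Hg' {}le_k.
have [[R0 R1 R3 R4] [R5 R6 R7 R8]] := HR.
(* Only the current pair can be both bad and newly left behind. *)
have behind p2 q2 : p <= p2 -> q2 <= q ->
  (forall p' q', p' < p2 \/ q2 < q' -> p' * q' = n \/ p' * q' = n.+1 ->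
     (p' < p \/ q < q') \/ p' = p /\ q' = q) -> p < p2 \/ q2 < q ->
  (R' 2 = 0 <-> n = 0 \/ exists p' q',
       1 < q' /\ (p' < p2 \/ q2 < q') /\ bad_pair p' q').
  move=> le2 le2' H lt2; rewrite Hg' Hg; split.
    case=> [[n0|[p' [q' [q'1 [lt bad]]]]]|bad]; first by left.
      by right; exists p', q'; do !split=> //; lia.
    by right; exists p, q; do !split=> //; lia.
  case=> [n0|[p' [q' [q'1 [lt bad]]]]]; first by left; left.
  have [|lt'|[<- <-]] := H p' q' lt; first by case: bad => -[]; lia.
    by left; right; exists p', q'.
  by right.
rewrite /pair_step; exec_ops.
eapply wp_ifz; [eval_reg | side | |] => Hpq; exec_ops.
- split; first by side.
  split=> //; exists p.+1, q; split; last first.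
    by split; [split|]; rewrite ?mulSn; lia.
  split; [by split; split; regs_simpl; lia | by [] | regs_simpl].
  apply: behind => //.
  (* With [p' = p], a smaller [q'] gives a product below [p * q <= n]. *)
  + move=> p' q'; nia.
  + by left.
- split; [side | exec_ops]; split; first by side.
  split=> //; exists p, (q - 1); split; last first.
    by split; [split|]; rewrite ?mulnBr; lia.
  split; [by split; split; regs_simpl; lia | by [] | regs_simpl].
  apply: behind => //.
  + lia.
  (* With [q' = q >= 2], a larger [p'] gives a product of at least [p * q + 2 > n + 1]. *)
  + move=> p' q'; nia.
  + by right; lia.
Qed.

End PairLoop.

(** * The decision program *)

(* The word is stored at address 0, its reversal at n + 1, and their Z-values at
   2 (n + 1) and 3 (n + 1). *)
Definition robust_cmd : cmd :=
  seqs [:: Op (OpConst 1 1); revcopy;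
    Op (OpConst 2 0); Op (OpAdd 3 0 1); Op (OpAdd 3 3 3); zfunc;
    Op (OpAdd 2 0 1); Op (OpAdd 3 2 2); Op (OpAdd 3 3 2); zfunc;
    Op (OpSub 2 1 0); Op (OpSub 2 1 2); Op (OpConst 3 1); Op (OpAdd 4 0 1);
    Op (OpAdd 5 0 1); Op (OpAdd 6 0 1); Op (OpAdd 7 6 6); Op (OpAdd 8 7 6);
    pair_loop].

Lemma wp_robust_cmd B n (Q : post) R M k c :
  14 * n + 20 <= B -> R 0 = n -> (forall j, j < n -> M j <= B) ->
  400 * n + c + 600 <= k ->
  (forall R' M' k' Z ZR,
     (forall i, i <= n -> zval M n i (Z i)) ->
     (forall i, i <= n -> zval (fun j => M (n.-1 - j)) n i (ZR i)) ->
     (R' 2 = 0 <-> n = 0 \/ exists p q, 1 < q /\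
       (p * q = n /\ n <= p + Z p \/ p * q = n.+1 /\ ins_test n Z ZR p)) ->
     c <= k' -> Q R' M' k') ->
  wp B robust_cmd Q R M k.
Proof.
move=> leB R0 MB le_k HQ; rewrite /robust_cmd; exec_ops.
apply: (wp_revcopy _ n _ _ _ _ (380 * n + c + 550)) => //; try side.
move=> {R0 le_k} {}R M1 {}k R0 R1 M1E M1R le_k; exec_ops.
apply: (wp_zfunc B n 0 (n.+1 + n.+1) _ _ _ _ _ _ (300 * n + c + 440));
  regs_simpl => //; try side.
  by move=> j lt_j; rewrite add0n M1E ?MB.
move=> {R0 R1 le_k} {}R M2 {}k R0 R1 M2E Z1 le_k; exec_ops.
apply: (wp_zfunc B n n.+1 (n.+1 + n.+1 + n.+1) _ _ _ _ _ _
  (220 * n + c + 330)); regs_simpl => //; rewrite ?addn1 //; try side.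
  by move=> j lt_j; rewrite M2E ?M1R ?MB //; lia.
move=> {R0 R1 le_k} {}R M3 {}k R0 R1 M3E Z2 le_k; exec_ops.
(* The second run of [zfunc] writes from [3 * n.+1] on, which spares the first table. *)
have HZ i : i <= n -> zval M n i (M3 (n.+1 + n.+1 + i)).
  move=> le_i; rewrite M3E; last by lia.
  by apply: eq_zval (Z1 i le_i) => j lt_j; apply: M1E.
have HZR i : i <= n ->
    zval (fun j => M (n.-1 - j)) n i (M3 (n.+1 + n.+1 + n.+1 + i)).
  move=> le_i; apply: eq_zval (Z2 i le_i) => j lt_j.
  by rewrite M2E ?M1R //; lia.
apply: (wp_pair_loop B n (n.+1 + n.+1) (n.+1 + n.+1 + n.+1) M3 _ _ _ _ _ _ c).
- lia.
- by move=> i /HZ[]; lia.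
- by move=> i /HZR[]; lia.
- by split; split; regs_simpl; rewrite ?addn1 ?mul1n.
(* Register 2 starts as [1 - (1 - n)], which is 0 only for the empty word. *)
- by regs_simpl; lia.
- by regs_simpl; lia.
- lia.
move=> R' k' le_g Hg {}le_k; apply: wp_skip.
by apply: (HQ _ _ _ (fun i => M3 (n.+1 + n.+1 + i))
  (fun i => M3 (n.+1 + n.+1 + n.+1 + i))).
Qed.

Definition robust_program : program :=
  compile 0 robust_cmd ++
  [:: OpJumpZero 2 (csize robust_cmd + 2); OpHalt true; OpHalt false].

Theorem theorem28 (V : finType) (hV : 1 < #|V|) :
  exists (P : program) (c : nat) (T : nat -> nat),
    bigO T (fun n => n) /\ decides_in_time P c T (@ins_robust V).
Proof.
(* The factor [(n + 2) ^ #|V|] makes room for the letter ranks, [(n + 2) ^ 5] for addresses and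
   products; the program is the same for every alphabet. *)
exists robust_program, (#|V| + 5), (fun n => 400 * n + 603); split.
  by exists 1003, 1 => n n0; lia.
move=> w; set n := size w; set B := _ ^ _.
have /card_gt0P[x0 _] : 0 < #|V| by lia.
have [VB nB] : #|V| <= B /\ 14 * n + 20 <= B.
  have n5 : 16 * (n + 2) <= (n + 2) ^ 5.
    by rewrite expnSr leq_mul2r (@leq_exp2r 2 _ 4) ?leq_addl ?orbT.
  have V2 : #|V| < (n + 2) ^ #|V|.
    by apply: ltn_expl; lia.
  have : ((n + 2) ^ #|V|) * 1 <= B by rewrite /B expnD leq_mul // expn_gt0; lia.
  have : 1 * (n + 2) ^ 5 <= B by rewrite /B expnD leq_mul // expn_gt0; lia.
  by lia.
set M := nth 0 [seq (enum_rank a : nat) | a <- w].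
have ME j : j < n -> M j = enum_rank (nth x0 w j).
  by move=> lt_j; rewrite /M (nth_map x0).
have MB j : j < n -> M j <= B.
  by move=> /ME ->; apply: leq_trans VB; rewrite ltnW.
set tl := [:: OpJumpZero 2 (csize robust_cmd + 2); OpHalt true; OpHalt false].
have := @wp_robust_cmd B n
  (fun R _ k => (R 2 <> 0 <-> ins_robust w) /\ 2 <= k)
  (update (fun=> 0) 0 n) M (400 * n + 603) 2 nB erefl MB.
(* The code that follows is the final test of register 2, paid by the two credits left. *)
move=> /(_ _ _ [::] tl
  (fun o => exists b : bool, o = Some b /\ (b <-> ins_robust w))).
apply=> [||R' M' [|[|k']] _ [Hw le_k]] //; first by lia.
- move=> R' M' k' Z ZR HZ HZR Hg le_k; split=> //.
  rewrite (@ins_robustP V x0 w M Z ZR) ?Hg // => i j lt_i lt_j.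
  by rewrite !ME //; split=> [/ord_inj/enum_rank_inj|->].
exists (R' 2 != 0); split; last by rewrite -Hw; split=> /eqP.
have szP := size_compile 0 robust_cmd; set P := [::] ++ _ ++ _.
rewrite add0n.
have -> : run B P k'.+2 (Config (csize robust_cmd) R' M') =
    run B P k'.+1 (Config (if R' 2 == 0 then csize robust_cmd + 2
      else (csize robust_cmd).+1) R' M').
  by rewrite (@run_instr B P (compile 0 robust_cmd) (behead tl)
    (head (OpHalt true) tl) (csize robust_cmd)).
case: eqP => _.
- by rewrite (@run_instr B P (compile 0 robust_cmd ++ take 2 tl) [::]
    (OpHalt false)) // ?size_cat ?szP.
- by rewrite (@run_instr B P (compile 0 robust_cmd ++ take 1 tl) (drop 2 tl)
    (OpHalt true)) // ?size_cat ?szP ?addn1.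
Qed.
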